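(* Let $\mathbb{F}$ be $\mathbb{R}$ or $\mathbb{C}$, and let $\underline{Y}=((A_1;A_2);(B_1;B_2))$ be a $2\times2\times2\times2$ tensor over $\mathbb{F}$. If $\mathrm{rank}_{\mathbb{F}}(A_1;A_2)\le2$, then $\mathrm{rank}_{\mathbb{F}}(\underline{Y})\le4$.
   Context: For $2\times2$ matrices $A_1,A_2$, $(A_1;A_2)$ is the $2\times2\times2$ tensor with slices $A_1,A_2$ (entries $(A_l)_{ij}$ at position $(i,j,l)$). For $2\times 2$ matrices $T_{kl}$, $((T_{11};T_{12});(T_{21};T_{22}))$ denotes the $2\times2\times2\times2$ tensor $(t_{ijkl})$ with $t_{ijkl}=(T_{kl})_{ij}$; so here $T_{11}=A_1$, $T_{12}=A_2$, $T_{21}=B_1$, $T_{22}=B_2$. A rank one tensor is an outer product of nonzero vectors; $\mathrm{rank}_{\mathbb{F}}$ is the smallest $s\ge 0$ such that the tensor is a sum of $s$ rank one tensors over $\mathbb{F}$. *)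

(* Defs.v *)
From HB Require Import structures.
From mathcomp Require Import all_boot all_order all_algebra.
From mathcomp Require Import boolp reals.
From mathcomp Require Import complex.

Set Implicit Arguments.
Unset Strict Implicit.
Unset Printing Implicit Defensive.

Import GRing.Theory.
Local Open Scope ring_scope.

Definition tensor3 (F : fieldType) (m n p : nat) : Type :=
  {ffun 'I_m * 'I_n * 'I_p -> F}.

Definition tensor4 (F : fieldType) (m n p q : nat) : Type :=
  {ffun 'I_m * 'I_n * 'I_p * 'I_q -> F}.

Section Rank.
Variable F : fieldType.

Definition outer3 m n p (u : 'rV[F]_m) (v : 'rV[F]_n) (w : 'rV[F]_p) :
    tensor3 F m n p :=
  [ffun x => let: (i, j, k) := x in u 0 i * v 0 j * w 0 k].

Definition outer4 m n p q
    (u : 'rV[F]_m) (v : 'rV[F]_n) (w : 'rV[F]_p) (z : 'rV[F]_q) :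
    tensor4 F m n p q :=
  [ffun x => let: (i, j, k, l) := x in u 0 i * v 0 j * w 0 k * z 0 l].

Definition rank_one3 m n p (T : tensor3 F m n p) : Prop :=
  exists u v w, [/\ u != 0, v != 0, w != 0 & T = outer3 u v w].

Definition rank_one4 m n p q (T : tensor4 F m n p q) : Prop :=
  exists u v w z,
    [/\ u != 0, v != 0, w != 0, z != 0 & T = outer4 u v w z].

Definition sum_rank_one3 m n p (T : tensor3 F m n p) (s : nat) : Prop :=
  exists2 f : 'I_s -> {ffun 'I_m * 'I_n * 'I_p -> F},
    forall a, rank_one3 (f a) & T = \sum_(a < s) f a.

Definition sum_rank_one4 m n p q (T : tensor4 F m n p q) (s : nat) : Prop :=
  exists2 f : 'I_s -> {ffun 'I_m * 'I_n * 'I_p * 'I_q -> F},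
    forall a, rank_one4 (f a) & T = \sum_(a < s) f a.

Lemma sum_nonzero (V : zmodType) (I : finType) (P : V -> Prop) (g : I -> V) :
  (forall i, g i != 0 -> P (g i)) ->
  exists s, exists2 f : 'I_s -> V,
    forall a, P (f a) & \sum_i g i = \sum_(a < s) f a.
Proof.
move=> Pg; pose A := [set i | g i != 0].
exists #|A|, (fun a => g (enum_val a)) => [a|].
  by apply: Pg; have := enum_valP a; rewrite inE.
rewrite (bigID [in A]) /= [X in _ + X]big1 ?addr0 => [|i].
  exact: big_enum_val.
by rewrite inE negbK => /eqP.
Qed.

Lemma delta_row_neq0 n (j : 'I_n) : delta_mx 0 j != 0 :> 'rV[F]_n.
Proof.
apply/eqP => /rowP/(_ j)/eqP.
by rewrite !mxE !eqxx oner_eq0.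
Qed.

Lemma ffun_delta_sum (I : finType) (T : {ffun I -> F}) :
  T = \sum_i [ffun x => T i * (x == i)%:R].
Proof.
apply/ffunP => x; rewrite sum_ffunE (bigD1 x) //= ffunE eqxx mulr1.
rewrite big1 ?addr0 // => i /negPf xi.
by rewrite ffunE eq_sym xi mulr0.
Qed.

Lemma sum_rank_one3_exists m n p (T : tensor3 F m n p) :
  exists s, `[< sum_rank_one3 T s >].
Proof.
suff [s Hs] : exists s, sum_rank_one3 T s by exists s; apply/asboolP.
have := @sum_nonzero _ _ (@rank_one3 m n p)
  (fun i => [ffun x => T i * (x == i)%:R]).
rewrite -ffun_delta_sum; apply=> -[[i j] k] nz.
have Tnz : T (i, j, k) != 0.
  apply: contraNneq nz => T0; apply/eqP/ffunP => x.
  by rewrite !ffunE T0 mul0r.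
exists (T (i, j, k) *: delta_mx 0 i), (delta_mx 0 j), (delta_mx 0 k).
split; rewrite ?scaler_eq0 ?negb_or ?Tnz ?delta_row_neq0 //.
apply/ffunP => -[[i' j'] k']; rewrite !ffunE !mxE !eqxx /= -!mulrA -!natrM.
by rewrite !xpair_eqE !mulnb -!andbA.
Qed.

Lemma sum_rank_one4_exists m n p q (T : tensor4 F m n p q) :
  exists s, `[< sum_rank_one4 T s >].
Proof.
suff [s Hs] : exists s, sum_rank_one4 T s by exists s; apply/asboolP.
have := @sum_nonzero _ _ (@rank_one4 m n p q)
  (fun i => [ffun x => T i * (x == i)%:R]).
rewrite -ffun_delta_sum; apply=> -[[[i j] k] l] nz.
have Tnz : T (i, j, k, l) != 0.
  apply: contraNneq nz => T0; apply/eqP/ffunP => x.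
  by rewrite !ffunE T0 mul0r.
exists (T (i, j, k, l) *: delta_mx 0 i), (delta_mx 0 j), (delta_mx 0 k),
  (delta_mx 0 l).
split; rewrite ?scaler_eq0 ?negb_or ?Tnz ?delta_row_neq0 //.
apply/ffunP => -[[[i' j'] k'] l'].
rewrite !ffunE !mxE !eqxx /= -!mulrA -!natrM.
by rewrite !xpair_eqE !mulnb -!andbA.
Qed.

Definition rank3 m n p (T : tensor3 F m n p) : nat :=
  ex_minn (sum_rank_one3_exists T).

Definition rank4 m n p q (T : tensor4 F m n p q) : nat :=
  ex_minn (sum_rank_one4_exists T).

Definition slices3 (A1 A2 : 'M[F]_2) : tensor3 F 2 2 2 :=
  [ffun x => let: (i, j, l) := x in (if l == 0 then A1 else A2) i j].

(* ((T11; T12); (T21; T22)): the third index selects the pair, the fourth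
   the matrix inside the pair. *)
Definition slices4 (T11 T12 T21 T22 : 'M[F]_2) : tensor4 F 2 2 2 2 :=
  [ffun x => let: (i, j, k, l) := x in
    (if k == 0 then (if l == 0 then T11 else T12)
               else (if l == 0 then T21 else T22)) i j].

End Rank.

(* Main.v *)
(** Y has rank at most 4 as soon as A = (A1; A2) and B = (B1; B2) both lie in
    the span of four rank one 2x2x2 tensors. Write A = t1 + t2 with t1, t2 of
    rank at most one. If the two factors are independent in every mode, change
    bases so that t1 and t2 are multiples of the two opposite corners of the
    cube; replacing both corner entries of B by a suitable z makes the
    hyperdeterminant of B, a monic quartic in z, a nonzero square, so the
    modified B has rank 2. Otherwise A is, up to a permutation of the modes,
    a (x) M. If M is singular, A has rank at most one and the first case
    applies. If M is invertible, reduce to A = e0 (x) I; then split the second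
    slice of B as p1 + p2 with p1, p2 of rank at most one and tr p1 <> 0, and
    choose z so that C = B_0 - z p1 has two distinct eigenvalues in the field.
    The spectral projections of C span both I and C, and B is recovered by
    adding (z, 1) (x) p1 and (0, 1) (x) p2. *)

Require Import Defs.
From HB Require Import structures.
From mathcomp Require Import all_boot all_order all_algebra.
From mathcomp Require Import boolp reals.
From mathcomp Require Import complex.
From mathcomp Require Import ring.

Set Implicit Arguments.
Unset Strict Implicit.
Unset Printing Implicit Defensive.

Local Open Scope ring_scope.

Import Order.TTheory GRing.Theory Num.Theory.

(** * Boolean-indexed arrays, shared rank one terms and changes of basis *)

Section Span.
Variable F : numFieldType.
Implicit Types (a b c u v w : bool -> F) (M N : bool -> bool -> F).
Implicit Types A B T : bool -> bool -> bool -> F.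

Definition det2 u v : F := u false * v true - u true * v false.

Definition detm M : F := M false false * M true true - M false true * M true false.

Lemma detm0_outer M : detm M = 0 -> exists p q, forall i j, M i j = p i * q j.
Proof.
rewrite /detm => /eqP; rewrite subr_eq0 => /eqP M0.
have [n00|n00] := eqVneq (M false false) 0; last first.
  exists (fun i => M i false / M false false), (M false) => -[] [];
    by apply: (mulfI n00); field: M0.
have [n01|n01] := eqVneq (M false true) 0; last first.
  have n10 : M true false = 0.
    by apply: (mulfI n01); rewrite mulr0 -M0 n00 mul0r.
  exists (fun i => M i true / M false true), (M false) => -[] [];
    by rewrite ?n00 ?n10; field.
exists (fun i => i%:R), (M true) => -[] [] /=; by rewrite ?n00 ?n01; ring.
Qed.

Lemma det2_colinear u v : det2 u v = 0 ->
  exists w x y, (forall i, u i = x * w i) /\ (forall i, v i = y * w i).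
Proof.
move=> uv0; have [|p [q pq]] := @detm0_outer (fun i => if i then v else u).
  by rewrite /detm -/(det2 u v).
exists q, (p false), (p true); split=> i.
  exact: (pq false).
exact: (pq true).
Qed.

(** The zero vector is covered too: the scalar [x] then vanishes while [a0] does not. *)
Lemma complete_basis a :
  exists a0 a1 x, det2 a0 a1 != 0 /\ (forall i, a i = x * a0 i).
Proof.
have [a0|a0] := eqVneq (a false) 0; last first.
  exists a, (fun i => i%:R), 1; rewrite /det2 /= mulr1 mulr0 subr0.
  by split=> // i; rewrite mul1r.
exists (fun i => i%:R), (fun i => (~~ i)%:R), (a true).
rewrite /det2 /= mul0r mul1r sub0r oppr_eq0 oner_eq0; split=> // -[] /=;
  by rewrite ?a0; ring.
Qed.

(** With [(x r, y r)] as the vector in the mode that separates [A] from [B], this is rank at most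
    four of the pair; zero factors are allowed. *)
Definition span4 A B := exists (x y : 'I_4 -> F) (u v w : 'I_4 -> bool -> F),
  forall i j k, A i j k = \sum_r x r * (u r i * v r j * w r k) /\
                B i j k = \sum_r y r * (u r i * v r j * w r k).

(** Quantifying over [B] leaves a property of [A] alone: base changes and permutations of modes can
    be undone on [B]. *)
Definition joint_rank4 A := forall B, span4 A B.

Lemma span4_intro A B (x1 x2 x3 x4 y1 y2 y3 y4 : F)
    u1 u2 u3 u4 v1 v2 v3 v4 w1 w2 w3 w4 :
  (forall i j k, A i j k = x1 * (u1 i * v1 j * w1 k) + x2 * (u2 i * v2 j * w2 k)
     + x3 * (u3 i * v3 j * w3 k) + x4 * (u4 i * v4 j * w4 k)) ->
  (forall i j k, B i j k = y1 * (u1 i * v1 j * w1 k) + y2 * (u2 i * v2 j * w2 k)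
     + y3 * (u3 i * v3 j * w3 k) + y4 * (u4 i * v4 j * w4 k)) ->
  span4 A B.
Proof.
move=> AE BE; exists (fun r => nth 0 [:: x1; x2; x3; x4] r).
exists (fun r => nth 0 [:: y1; y2; y3; y4] r).
exists (fun r => nth u1 [:: u1; u2; u3; u4] r).
exists (fun r => nth u1 [:: v1; v2; v3; v4] r).
exists (fun r => nth u1 [:: w1; w2; w3; w4] r) => i j k.
by rewrite AE BE !big_ord_recl !big_ord0 /= !addr0 !addrA.
Qed.

Lemma joint_rank4_ext A A' : (forall i j k, A i j k = A' i j k) ->
  joint_rank4 A' -> joint_rank4 A.
Proof.
move=> AA' A'4 B; have [x [y [u [v [w E]]]]] := A'4 B.
by exists x, y, u, v, w => i j k; rewrite AA'.
Qed.

(** Carries base changes in the first mode over to the other two. *)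
Lemma joint_rank4_cycle A :
  joint_rank4 (fun i j k => A j k i) -> joint_rank4 A.
Proof.
move=> A4 B; have [x [y [u [v [w E]]]]] := A4 (fun i j k => B j k i).
exists x, y, v, w, u => i j k; have [-> ->] := E k i j.
by split; apply: eq_bigr => r _; ring.
Qed.

Lemma joint_rank4_basis a a' A : det2 a a' != 0 -> joint_rank4 A ->
  joint_rank4 (fun i j k => a i * A false j k + a' i * A true j k).
Proof.
move=> D A4 B.
(* Coordinates of [B] in the basis [a], [a'], by Cramer's rule. *)
pose B' p j k := (if p then a false * B true j k - a true * B false j k
  else a' true * B false j k - a' false * B true j k) / det2 a a'.
have [x [y [u [v [w E]]]]] := A4 B'.
exists x, y, (fun r i => a i * u r false + a' i * u r true), v, w => i j k.
have [-> _] := E false j k; have [-> _] := E true j k; split.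
  by rewrite !mulr_sumr -big_split /=; apply: eq_bigr => r _; ring.
transitivity (a i * B' false j k + a' i * B' true j k).
  by rewrite /B'; move: D; rewrite /det2 => D; case: i; field.
have [_ ->] := E false j k; have [_ ->] := E true j k.
by rewrite !mulr_sumr -big_split /=; apply: eq_bigr => r _; ring.
Qed.

Lemma binary_form_roots (p q r d : F) : d != 0 -> q ^+ 2 - 4 * p * r = d ^+ 2 ->
  exists s1 t1 s2 t2, [/\ s1 * t2 - s2 * t1 != 0,
    p * s1 ^+ 2 + q * s1 * t1 + r * t1 ^+ 2 = 0 &
    p * s2 ^+ 2 + q * s2 * t2 + r * t2 ^+ 2 = 0].
Proof.
move=> d0 dE; have [p0|p0] := eqVneq p 0.
  (* The form is [t * (q * s + r * t)], and [q] is nonzero because the discriminant is. *)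
  exists 1, 0, r, (- q); split; last 2 first.
  - by rewrite p0; ring.
  - by rewrite p0; ring.
  rewrite mul1r mulr0 subr0 oppr_eq0; apply: contraNneq d0 => q0.
  by rewrite -sqrf_eq0 -dE p0 q0 !(mulr0, mul0r) expr0n subr0.
exists (- q + d), (2 * p), (- q - d), (2 * p); split.
- have -> : (- q + d) * (2 * p) - (- q - d) * (2 * p) = 4 * p * d by ring.
  by rewrite !mulf_neq0 // pnatr_eq0.
- transitivity (p * (d ^+ 2 - (q ^+ 2 - 4 * p * r))); first by ring.
  by rewrite dE subrr mulr0.
- transitivity (p * (d ^+ 2 - (q ^+ 2 - 4 * p * r))); first by ring.
  by rewrite dE subrr mulr0.
Qed.

(* The discriminant of the form [s, t |-> det (s T_0 + t T_1)]. *)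
Definition hyperdet T : F :=
  (T false false false * T true true true + T true false false * T false true true
   - T false false true * T true true false - T false true false * T true false true) ^+ 2
  - 4 * detm (T false) * detm (T true).

(* The roots of that form give two rank one matrices spanning the slices. *)
Lemma hyperdet_square_rank2 T d : d != 0 -> hyperdet T = d ^+ 2 ->
  exists u1 v1 w1 u2 v2 w2,
    forall i j k, T i j k = u1 i * v1 j * w1 k + u2 i * v2 j * w2 k.
Proof.
move=> d0 /(binary_form_roots d0) [s1 [t1 [s2 [t2 [D E1 E2]]]]].
have [|v1 [w1 vw1]] := @detm0_outer (fun j k => s1 * T false j k + t1 * T true j k).
  by rewrite -E1 /detm; ring.
have [|v2 [w2 vw2]] := @detm0_outer (fun j k => s2 * T false j k + t2 * T true j k).
  by rewrite -E2 /detm; ring.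
(* Inverting the 2x2 matrix of the two roots recovers the slices of [T]. *)
exists (fun i => (if i then - s2 else t2) / (s1 * t2 - s2 * t1)), v1, w1.
exists (fun i => (if i then s1 else - t1) / (s1 * t2 - s2 * t1)), v2, w2.
by move=> i j k; rewrite -!mulrA -vw1 -vw2; case: i; field.
Qed.

(** * From the two normal forms to every array of rank at most two *)

Section Squares.
(* Holds in real closed fields and in algebraically closed ones, which lets both
   cases of the theorem share the rest of the argument. *)
Hypothesis quartic_square : forall a b c : F,
  exists x d, d != 0 /\ x ^+ 4 + a * x ^+ 2 + b * x + c = d ^+ 2.

Lemma joint_rank4_corners (x y : F) : joint_rank4 (fun i j k =>
  x * ((~~ i)%:R * (~~ j)%:R * (~~ k)%:R) + y * (i%:R * j%:R * k%:R)).
Proof.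
move=> B.
pose T z i j k := if i && j && k then z else if i || j || k then B i j k else z.
have [z [d [d0 zd]]] : exists z d, d != 0 /\ hyperdet (T z) = d ^+ 2.
  (* [P], [Q], [S] and [z ^+ 2] are the products of antipodal entries of [T z]; Cayley's expansion
     of the hyperdeterminant in them gives the quartic below. *)
  pose P := B false false true * B true true false.
  pose Q := B false true false * B true false true.
  pose S := B true false false * B false true true.
  have [z [d [d0 zd]]] := quartic_square (- 2 * (P + Q + S))
   (4 * (B false true true * B true false true * B true true false
         + B true false false * B false true false * B false false true))
   ((P + Q + S) ^+ 2 - 4 * (P * Q + Q * S + P * S)).
  exists z, d; split=> //; rewrite -zd /hyperdet /detm /T /= /P /Q /S; ring.
have [u1 [v1 [w1 [u2 [v2 [w2 E]]]]]] := hyperdet_square_rank2 d0 zd.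
apply: (@span4_intro _ _ x y 0 0 (B false false false - z) (B true true true - z)
  1 1 (fun i => (~~ i)%:R) (fun i => i%:R) u1 u2 (fun i => (~~ i)%:R)
  (fun i => i%:R) v1 v2 (fun i => (~~ i)%:R) (fun i => i%:R) w1 w2) => i j k.
  by rewrite !mul0r !addr0.
by rewrite !mul1r -[RHS]addrA -E /T; case: i j k => [] [] [] /=; ring.
Qed.

Lemma joint_rank4_generic a a' b b' c c' (x y : F) :
  det2 a a' != 0 -> det2 b b' != 0 -> det2 c c' != 0 ->
  joint_rank4 (fun i j k => x * (a i * b j * c k) + y * (a' i * b' j * c' k)).
Proof.
move=> Da Db Dc; have := joint_rank4_corners x y.
move=> /(joint_rank4_basis Da) J; apply: joint_rank4_ext; last first.
  apply/joint_rank4_cycle/(joint_rank4_basis Dc).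
  apply/joint_rank4_cycle/(joint_rank4_basis Db).
  by apply/joint_rank4_cycle; exact: J.
by move=> i j k /=; ring.
Qed.

Lemma joint_rank4_rank1 a b c : joint_rank4 (fun i j k => a i * b j * c k).
Proof.
have [a0 [a1 [x [Da aE]]]] := complete_basis a.
have [b0 [b1 [y [Db bE]]]] := complete_basis b.
have [c0 [c1 [z [Dc cE]]]] := complete_basis c.
have := joint_rank4_generic (x * y * z) 0 Da Db Dc.
by apply: joint_rank4_ext => i j k; rewrite aE bE cE; ring.
Qed.

(** The nonzero trace keeps a discriminant in [joint_rank4_id] of degree two in [z]. *)
Lemma nonzero_trace_split M : exists p1 p2, [/\ detm p1 = 0, detm p2 = 0,
  p1 false false + p1 true true != 0 & forall j k, M j k = p1 j k + p2 j k].
Proof.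
have [m11|m11] := eqVneq (M true true) 0.
  exists (fun j k => if j then 0 else if k then M false true else 1).
  exists (fun j k => if k then 0 else if j then M true false else M false false - 1).
  rewrite /detm; split=> /=; [by ring|by ring|by rewrite addr0 oner_eq0|].
  by move=> [] []; rewrite ?m11; ring.
exists (fun j k => if j then M true k else 0).
exists (fun j k => if j then 0 else M false k).
rewrite /detm; split=> /=; [by ring|by ring|by rewrite add0r|].
by move=> [] []; ring.
Qed.

Lemma joint_rank4_id : joint_rank4 (fun i j k => (~~ i)%:R * (j == k)%:R).
Proof.
move=> B; have [p1 [p2 [p10 p20 tr Bp]]] := nonzero_trace_split (B true).
set t := p1 false false + p1 true true in tr.
pose C z j k := B false j k - z * p1 j k.
have [z [d [d0 zd]]] : exists z d, d != 0 /\
    (C z false false + C z true true) ^+ 2 - 4 * detm (C z) = d ^+ 2.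
  (* As [detm p1 = 0], the discriminant is [t ^+ 2 * z ^+ 2 + e * z] plus a constant;
     [z = y ^+ 2 / t] makes it a monic quartic in [y]. *)
  pose e := 4 * (B false false false * p1 true true
    + B false true true * p1 false false - B false false true * p1 true false
    - B false true false * p1 false true)
    - 2 * t * (B false false false + B false true true).
  have [y [d [d0 yd]]] := quartic_square (e / t) 0
    ((B false false false + B false true true) ^+ 2 - 4 * detm (B false)).
  exists (y ^+ 2 / t), d; split=> //; rewrite -yd.
  transitivity ((y ^+ 2 / t * t) ^+ 2 + e * (y ^+ 2 / t)
   + ((B false false false + B false true true) ^+ 2 - 4 * detm (B false))
   - 4 * (y ^+ 2 / t) ^+ 2 * detm p1).
    by rewrite /C /e /detm /t; ring.
  by rewrite p10 divfK //; field.
pose l1 := (C z false false + C z true true + d) / 2.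
pose l2 := (C z false false + C z true true - d) / 2.
(* Spectral projections of [C z] for the eigenvalues [l1] and [l2], where [d = l1 - l2]. *)
have [|v1 [w1 vw1]] := @detm0_outer (fun j k => (C z j k - l2 * (j == k)%:R) / d).
  transitivity ((d ^+ 2 - ((C z false false + C z true true) ^+ 2
    - 4 * detm (C z))) / (4 * d ^+ 2)).
    by rewrite /detm /l2 /=; field.
  by rewrite zd subrr mul0r.
have [|v2 [w2 vw2]] := @detm0_outer (fun j k => (l1 * (j == k)%:R - C z j k) / d).
  transitivity ((d ^+ 2 - ((C z false false + C z true true) ^+ 2
    - 4 * detm (C z))) / (4 * d ^+ 2)).
    by rewrite /detm /l1 /=; field.
  by rewrite zd subrr mul0r.
have [f1 [g1 fg1]] := detm0_outer p10; have [f2 [g2 fg2]] := detm0_outer p20.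
apply: (@span4_intro _ _ 1 1 0 0 l1 l2 1 1 (fun i => (~~ i)%:R)
  (fun i => (~~ i)%:R) (fun i => if i then 1 else z) (fun i => i%:R)
  v1 v2 f1 f2 w1 w2 g1 g2) => i j k.
  by rewrite -!mulrA -vw1 -vw2 /l1 /l2; field.
rewrite -!mulrA -vw1 -vw2 -fg1 -fg2; case: i => /=.
  by rewrite Bp; ring.
have -> : B false j k = C z j k + z * p1 j k by rewrite /C; ring.
by rewrite /l1 /l2; field.
Qed.

Lemma joint_rank4_slice a M : joint_rank4 (fun i j k => a i * M j k).
Proof.
have [M0|M0] := eqVneq (detm M) 0.
  have [p [q pq]] := detm0_outer M0.
  by apply: joint_rank4_ext (joint_rank4_rank1 a p q) => i j k; rewrite pq mulrA.
have [a0 [a1 [x [Da aE]]]] := complete_basis a.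
have [x0|x0] := eqVneq x 0.
  apply: joint_rank4_ext (joint_rank4_rank1 (fun=> 0) (fun=> 0) (fun=> 0)).
  by move=> i j k; rewrite aE x0; ring.
(* The columns of [x M] form the basis that turns the identity into [x M]. *)
have D : det2 (fun j => x * M j false) (fun j => x * M j true) != 0.
  have -> : det2 (fun j => x * M j false) (fun j => x * M j true)
    = x ^+ 2 * detm M by rewrite /det2 /detm; ring.
  by rewrite mulf_neq0 ?expf_neq0.
apply: joint_rank4_ext; last first.
  apply/joint_rank4_cycle/joint_rank4_cycle/(joint_rank4_basis D).
  by apply/joint_rank4_cycle/(joint_rank4_basis Da)/joint_rank4_id.
by move=> i j k /=; rewrite aE; case: k => /=; ring.
Qed.

Lemma joint_rank4_rank2 a b c a' b' c' :
  joint_rank4 (fun i j k => a i * b j * c k + a' i * b' j * c' k).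
Proof.
have [Da|Da] := eqVneq (det2 a a') 0.
  have [e [x [y [aE a'E]]]] := det2_colinear Da.
  apply: joint_rank4_ext (joint_rank4_slice e
    (fun j k => x * b j * c k + y * b' j * c' k)) => i j k.
  by rewrite aE a'E; ring.
have [Db|Db] := eqVneq (det2 b b') 0.
  have [e [x [y [bE b'E]]]] := det2_colinear Db.
  apply/joint_rank4_cycle/joint_rank4_cycle.
  apply: joint_rank4_ext (joint_rank4_slice e
    (fun k i => x * a i * c k + y * a' i * c' k)) => j k i /=.
  by rewrite bE b'E; ring.
have [Dc|Dc] := eqVneq (det2 c c') 0.
  have [e [x [y [cE c'E]]]] := det2_colinear Dc.
  apply/joint_rank4_cycle.
  apply: joint_rank4_ext (joint_rank4_slice e
    (fun i j => x * a i * b j + y * a' i * b' j)) => k i j /=.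
  by rewrite cE c'E; ring.
apply: joint_rank4_ext (joint_rank4_generic 1 1 Da Db Dc) => i j k.
by rewrite !mul1r.
Qed.

End Squares.
End Span.

(** * Tensor rank and sums of possibly zero products *)

Section RankBounds.
Variable F : fieldType.

(** Ranks zero and one are padded with zero products. *)
Lemma rank3_le2P m n p (T : tensor3 F m n p) : (rank3 T <= 2)%N ->
  exists u1 v1 w1 u2 v2 w2, T = outer3 u1 v1 w1 + outer3 u2 v2 w2.
Proof.
have outer0 : outer3 0 0 0 = 0 :> {ffun 'I_m * 'I_n * 'I_p -> F}.
  by apply/ffunP => -[[i j] k]; rewrite !ffunE !mxE mulr0.
rewrite /rank3; case: ex_minnP => s /asboolP [f f1 ->] _.
case: s f f1 => [|[|[|//]]] f f1 _.
- by exists 0, 0, 0, 0, 0, 0; rewrite big_ord0 outer0 addr0.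
- have [u [v [w [_ _ _ E]]]] := f1 ord0.
  by exists u, v, w, 0, 0, 0; rewrite big_ord1 E outer0 addr0.
have [u [v [w [_ _ _ E]]]] := f1 ord0.
have [u' [v' [w' [_ _ _ E']]]] := f1 ord_max.
exists u, v, w, u', v', w'; rewrite -E -E' big_ord_recl big_ord1.
by congr (_ + f _); apply: val_inj.
Qed.

(** Zero terms are dropped; a nonzero product has nonzero factors. *)
Lemma rank4_le_sum m n p q s (u : 'I_s -> 'rV[F]_m) (v : 'I_s -> 'rV[F]_n)
    (w : 'I_s -> 'rV[F]_p) (z : 'I_s -> 'rV[F]_q) (T : tensor4 F m n p q) :
  T = \sum_r outer4 (u r) (v r) (w r) (z r) -> (rank4 T <= s)%N.
Proof.
move=> TE; pose g r : {ffun 'I_m * 'I_n * 'I_p * 'I_q -> F} :=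
  outer4 (u r) (v r) (w r) (z r).
pose N := [set r | g r != 0].
suff TN : sum_rank_one4 T #|N|.
  rewrite /rank4; case: ex_minnP => t _ /(_ #|N|) le_t.
  apply: leq_trans (le_t _) _; first exact/asboolP.
  by rewrite -[leqRHS]card_ord max_card.
exists (fun r => g (enum_val r)) => [r|].
  have := enum_valP r; rewrite inE; set k := enum_val r => gk.
  exists (u k), (v k), (w k), (z k).
  split=> //; apply: contraNneq gk => E; apply/eqP/ffunP => -[[[a b] c] d];
    by rewrite /g /outer4 !ffunE E mxE !(mul0r, mulr0).
rewrite TE (bigID [in N]) /= [X in _ + X]big1 ?addr0 => [|r].
  exact: big_enum_val.
by rewrite inE negbK => /eqP.
Qed.

End RankBounds.

(** * Transfer from boolean arrays to tensors *)

Lemma rank4_slices_le4 (F : numFieldType) :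
  (forall a b c : F,
    exists x d, d != 0 /\ x ^+ 4 + a * x ^+ 2 + b * x + c = d ^+ 2) ->
  forall A1 A2 B1 B2 : 'M[F]_2, (rank3 (slices3 A1 A2) <= 2)%N ->
    (rank4 (slices4 A1 A2 B1 B2) <= 4)%N.
Proof.
move=> sqF A1 A2 B1 B2 /rank3_le2P [u1 [v1 [w1 [u2 [v2 [w2 AE]]]]]].
pose o (i : bool) : 'I_2 := if i then 1 else 0.
pose b (i : 'I_2) := i != 0.
have bK i : o (b i) = i by case: i => [] [|[|//]] ?; apply: val_inj.
have [|x [y [u [v [w E]]]]] := @joint_rank4_ext F
   (fun i j k => (if k then A2 else A1) (o i) (o j)) _ _
  (joint_rank4_rank2 sqF (u1 0 \o o) (v1 0 \o o) (w1 0 \o o)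
     (u2 0 \o o) (v2 0 \o o) (w2 0 \o o))
  (fun i j k => (if k then B2 else B1) (o i) (o j)).
  move=> i j k; have := congr1 (fun T : {ffun _ -> F} => T (o i, o j, o k)) AE.
  by rewrite !ffunE /= => <-; case: k.
(* The new third mode carries [(x r, y r)]; the last mode of the arrays becomes the fourth. *)
apply: (@rank4_le_sum _ _ _ _ _ _ (fun r => \row_i u r (b i))
  (fun r => \row_i v r (b i)) (fun r => \row_i (if i == 0 then x r else y r))
  (fun r => \row_i w r (b i))).
apply/ffunP => -[[[i j] k] l]; rewrite sum_ffunE ffunE.
have [] := E (b i) (b j) (b l); rewrite !bK => AE' BE'.
transitivity (if k == 0 then (if b l then A2 else A1) i j
  else (if b l then B2 else B1) i j).
  by rewrite /b; case: (k == 0); case: (l == 0).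
rewrite AE' BE'; case: ifP => k0; apply: eq_bigr => r _;
  by rewrite !ffunE !mxE k0; ring.
Qed.

(** * Nonzero square values of quartics over real closed and algebraically closed fields *)

Lemma quartic_dominates (F : numFieldType) (a b c : F) :
  exists2 x, 0 <= x & `|a * x ^+ 2 + b * x + c| < x ^+ 4.
Proof.
(* At [x = 1 + s >= 1] the lower terms are at most [s * x ^+ 2], and [s < x <= x ^+ 2]. *)
pose s := `|a| + `|b| + `|c|; have s0 : 0 <= s by rewrite !addr_ge0.
exists (1 + s); first by rewrite addr_ge0.
have x1 : 1 <= 1 + s by rewrite lerDl.
have x0 : 0 <= 1 + s by rewrite addr_ge0.
apply: (@le_lt_trans _ _ (s * (1 + s) ^+ 2)).
  rewrite !mulrDl; apply: le_trans (ler_normD _ _) _; apply: lerD.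
    apply: le_trans (ler_normD _ _) _; apply: lerD.
      by rewrite normrM (ger0_norm (exprn_ge0 _ x0)).
    by rewrite normrM (ger0_norm x0) ler_wpM2l // expr2 ler_peMr.
  by rewrite ler_peMr // exprn_ege1.
rewrite (exprD _ 2 2) ltr_pM2r ?exprn_gt0 ?(lt_le_trans ltr01) //.
by apply: (@lt_le_trans _ _ (1 + s)); rewrite ?ltrDr // expr2 ler_peMr.
Qed.

Lemma rcf_quartic_square (R : rcfType) (a b c : R) :
  exists x d, d != 0 /\ x ^+ 4 + a * x ^+ 2 + b * x + c = d ^+ 2.
Proof.
have [x _ xb] := quartic_dominates a b c.
have q0 : 0 < x ^+ 4 + a * x ^+ 2 + b * x + c.
  rewrite -!addrA -ltrBlDr sub0r addrA; apply: le_lt_trans xb.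
  by rewrite -normrN ler_norm.
exists x, (Num.sqrt (x ^+ 4 + a * x ^+ 2 + b * x + c)).
by rewrite sqr_sqrtr ?ltW // gt_eqF ?sqrtr_gt0.
Qed.

(** Square roots always exist here; domination by [x ^+ 4] only serves to make the value nonzero. *)
Lemma closed_quartic_square (C : numClosedFieldType) (a b c : C) :
  exists x d, d != 0 /\ x ^+ 4 + a * x ^+ 2 + b * x + c = d ^+ 2.
Proof.
have [x x0 xb] := quartic_dominates a b c.
exists x, (sqrtC (x ^+ 4 + a * x ^+ 2 + b * x + c)); rewrite sqrtCK; split=> //.
rewrite sqrtC_eq0; apply: contraTneq xb => /eqP.
rewrite -!addrA addr_eq0 addrA => /eqP xE.
by rewrite -normrN -xE ger0_norm ?exprn_ge0 // ltxx.
Qed.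

Theorem proposition4p4 (R : realType) :
  (forall A1 A2 B1 B2 : 'M[R]_2,
     (rank3 (slices3 A1 A2) <= 2)%N ->
     (rank4 (slices4 A1 A2 B1 B2) <= 4)%N)
  /\
  (forall A1 A2 B1 B2 : 'M[complex R]_2,
     (rank3 (slices3 A1 A2) <= 2)%N ->
     (rank4 (slices4 A1 A2 B1 B2) <= 4)%N).
Proof.
split; first exact: (rank4_slices_le4 (@rcf_quartic_square R)).
exact: (rank4_slices_le4 (@closed_quartic_square (complex R))).
Qed.
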